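(* Let $K$ be a differential field of characteristic $0$, and let $u$ be an element of a differential extension of $K$ such that $u'=a\in K$, where $a$ is not a derivative in $K$ (i.e. there is no $b\in K$ with $b'=a$). Then $u$ is transcendental over $K$, $K(u)$ is a Picard-Vessiot extension of $K$, and its differential Galois group is isomorphic to the additive group of constants of $K$.
   Context: A differential field is a field with one derivation $y\mapsto y'$; its constants are the elements of derivative zero. For elements $u_1,\dots,u_n$ of a differential extension of $K$, $K(u_1,\dots,u_n)$ denotes the differential subfield generated by $K$ and $u_1,\dots,u_n$. Elements $u_1,\dots,u_n$ that are solutions of a homogeneous linear differential equation of order $n$ over $K$ form a fundamental system of solutions if their wronskian $\det(u_i^{(j-1)})_{1\le i,j\le n}$ is nonzero. A differential extension $M\supseteq K$ is a Picard-Vessiot extension of $K$ if $M=K(u_1,\dots,u_n)$ for a fundamental system of solutions $(u_1,\dots,u_n)$ of some homogeneous linear differential equation over $K$ and $M$ has the same field of constants as $K$. The differential Galois group of $M/K$ is the group of all differential field automorphisms of $M$ fixing $K$ elementwise. *)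

(* Defs.v *)
From HB Require Import structures.
From mathcomp Require Import all_boot all_algebra.
From mathcomp Require Import boolp.

Set Implicit Arguments.
Unset Strict Implicit.
Unset Printing Implicit Defensive.

Import GRing.Theory.
Local Open Scope ring_scope.

HB.mixin Record Field_isDifferential F of GRing.Field F := {
  der : F -> F;
  derD : {morph der : x y / x + y};
  derM : forall x y, der (x * y) = der x * y + x * der y
}.

#[short(type="diffFieldType")]
HB.structure Definition DifferentialField :=
  { F of Field_isDifferential F & GRing.Field F }.

(* Injectivity is automatic, so a differential morphism K -> L is the same
   thing as a differential extension L of K. *)
HB.mixin Record isDifferentialMorphism (K L : diffFieldType) (f : K -> L) := {
  morph_der : {morph f : x / der x >-> der x}
}.

HB.structure Definition DifferentialMorphism (K L : diffFieldType) :=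
  { f of isDifferentialMorphism K L f & @GRing.RMorphism K L f }.

Notation "{ 'diffmorphism' K -> L }" := (DifferentialMorphism.type K L)
  (at level 0, K at level 98, L at level 99,
   format "{ 'diffmorphism'  K  ->  L }") : type_scope.

Section DerivationTheory.
Variable F : diffFieldType.
Implicit Types x y : F.

Lemma der0 : der (0 : F) = 0.
Proof. by apply: (addIr (der 0)); rewrite -derD !add0r. Qed.

Lemma derN x : der (- x) = - der x.
Proof. by apply: (addIr (der x)); rewrite -derD !addNr der0. Qed.

Lemma derB x y : der (x - y) = der x - der y.
Proof. by rewrite derD derN. Qed.

End DerivationTheory.

Definition is_constant (F : diffFieldType) : pred F := [pred x | der x == 0].

Fact is_constant_zmod_closed (F : diffFieldType) :
  zmod_closed (@is_constant F).
Proof.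
split=> [|x y]; rewrite !inE ?der0 // => /eqP x0 /eqP y0.
by rewrite derB x0 y0 subrr.
Qed.

HB.instance Definition _ (F : diffFieldType) :=
  GRing.isZmodClosed.Build F (@is_constant F) (@is_constant_zmod_closed F).

Record constants (F : diffFieldType) :=
  Constant { constant_val :> F; _ : constant_val \in @is_constant F }.

HB.instance Definition _ (F : diffFieldType) :=
  [isSub for @constant_val F].
HB.instance Definition _ (F : diffFieldType) :=
  [Choice of constants F by <:].
HB.instance Definition _ (F : diffFieldType) :=
  [SubChoice_isSubZmodule of constants F by <:].

Definition diff_subfield (L : diffFieldType) (S : {pred L}) : Prop :=
  divring_closed S /\ {in S, forall x, der x \in S}.

(* The elements of K(us): those lying in every differential subfield of L that
   contains the image of K and the members of us. *)
Definition in_adjoin (K L : diffFieldType) (iota : {diffmorphism K -> L})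
    (us : seq L) : pred L :=
  [pred x | `[< forall S : {pred L}, diff_subfield S ->
                  (forall k, iota k \in S) -> {subset us <= S} -> x \in S >]].

Section Adjoin.
Variables (K L : diffFieldType) (iota : {diffmorphism K -> L}) (us : seq L).
Local Notation A := (in_adjoin iota us).

Fact in_adjoin_divring_closed : divring_closed A.
Proof.
split=> [|x y|x y]; rewrite !inE.
- by apply/asboolP => S [[]].
- move=> /asboolP Ax /asboolP Ay; apply/asboolP => S dS KS uS.
  by have [[_ cB _] _] := dS; apply: cB; [apply: Ax | apply: Ay].
- move=> /asboolP Ax /asboolP Ay; apply/asboolP => S dS KS uS.
  by have [[_ _ cV] _] := dS; apply: cV; [apply: Ax | apply: Ay].
Qed.

Fact in_adjoin_der x : x \in A -> der x \in A.
Proof.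
rewrite !inE => /asboolP Ax; apply/asboolP => S dS KS uS.
by have [_ cD] := dS; apply: cD; apply: Ax.
Qed.

Fact in_adjoin_base k : iota k \in A.
Proof. by rewrite inE; apply/asboolP => S _ KS _; apply: KS. Qed.

HB.instance Definition _ :=
  GRing.isDivringClosed.Build L A in_adjoin_divring_closed.

Record adjoin := Adjoin { adjoin_val :> L; _ : adjoin_val \in A }.

HB.instance Definition _ := [isSub for adjoin_val].
HB.instance Definition _ := [Choice of adjoin by <:].
HB.instance Definition _ := [SubChoice_isSubComUnitRing of adjoin by <:].
HB.instance Definition _ :=
  [SubComUnitRing_isSubIntegralDomain of adjoin by <:].
HB.instance Definition _ := [SubIntegralDomain_isSubField of adjoin by <:].

Definition adjoin_der (x : adjoin) : adjoin := Adjoin (in_adjoin_der (valP x)).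

Fact adjoin_derD : {morph adjoin_der : x y / x + y}.
Proof. by move=> x y; apply: val_inj; rewrite /= derD. Qed.

Fact adjoin_derM x y :
  adjoin_der (x * y) = adjoin_der x * y + x * adjoin_der y.
Proof. by apply: val_inj; rewrite /= derM. Qed.

HB.instance Definition _ :=
  Field_isDifferential.Build adjoin adjoin_derD adjoin_derM.

Definition adjoin_base (k : K) : adjoin := Adjoin (in_adjoin_base k).

Fact adjoin_base_zmod_morphism : zmod_morphism adjoin_base.
Proof. by move=> x y; apply: val_inj; rewrite /= rmorphB. Qed.

Fact adjoin_base_monoid_morphism : monoid_morphism adjoin_base.
Proof.
by split=> [|x y]; apply: val_inj; rewrite /= ?rmorph1 ?rmorphM.
Qed.

Fact adjoin_base_der : {morph adjoin_base : x / der x >-> der x}.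
Proof. by move=> x; apply: val_inj; rewrite /= morph_der. Qed.

HB.instance Definition _ :=
  GRing.isZmodMorphism.Build K adjoin adjoin_base adjoin_base_zmod_morphism.
HB.instance Definition _ :=
  GRing.isMonoidMorphism.Build K adjoin adjoin_base
    adjoin_base_monoid_morphism.
HB.instance Definition _ :=
  isDifferentialMorphism.Build K adjoin adjoin_base adjoin_base_der.

End Adjoin.

Section PicardVessiot.
Variables (K M : diffFieldType) (iota : {diffmorphism K -> M}).

Definition wronskian (n : nat) (u : 'I_n -> M) : M :=
  \det (\matrix_(i < n, j < n) iter j der (u i)).

(* c encodes c_0 y + c_1 y' + ... + c_n y^(n) = 0. *)
Definition is_solution (n : nat) (c : 'I_n.+1 -> K) (y : M) : Prop :=
  \sum_(k < n.+1) iota (c k) * iter k der y = 0.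

Definition fundamental_system (n : nat) (c : 'I_n.+1 -> K) (u : 'I_n -> M) :
    Prop :=
  (forall i, is_solution c (u i)) /\ wronskian u != 0.

Definition PicardVessiot : Prop :=
  (exists (n : nat) (c : 'I_n.+1 -> K) (u : 'I_n -> M),
    [/\ (0 < n)%N, c ord_max != 0, fundamental_system c u
      & forall x : M, x \in in_adjoin iota (codom u)]) /\
  (forall x : M, x \in @is_constant M <->
     exists2 k : K, k \in @is_constant K & iota k = x).

Definition is_diff_galois (f : M -> M) : Prop :=
  [/\ {morph f : x y / x + y}, {morph f : x y / x * y},
      {morph f : x / der x >-> der x}, bijective f
    & forall k, f (iota k) = iota k].

Record diffGal :=
  DiffGal { diffGal_fun :> M -> M; _ : `[< is_diff_galois diffGal_fun >] }.

HB.instance Definition _ := [isSub for diffGal_fun].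
HB.instance Definition _ := [Choice of diffGal by <:].

Lemma diffGalP (s : diffGal) : is_diff_galois s.
Proof. exact/asboolP/(valP s). Qed.

Fact diffGal_one_subproof : is_diff_galois id.
Proof. by split=> //; exists id. Qed.

Fact diffGal_mul_subproof (s t : diffGal) : is_diff_galois (s \o t).
Proof.
have [sD sM sd sb sK] := diffGalP s; have [tD tM td tb tK] := diffGalP t.
split=> [x y|x y|x||k] /=; rewrite ?tD ?tM ?td ?tK //; exact: bij_comp.
Qed.

Fact diffGal_inv_exists (s : diffGal) :
  exists g : M -> M, [/\ is_diff_galois g, cancel g s & cancel s g].
Proof.
have [sD sM sd [g sg gs] sK] := diffGalP s.
exists g; split=> //; split.
- by move=> x y; apply: (can_inj sg); rewrite sD !gs.
- by move=> x y; apply: (can_inj sg); rewrite sM !gs.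
- by move=> x; apply: (can_inj sg); rewrite sd !gs.
- by exists s.
- by move=> k; apply: (can_inj sg); rewrite sK gs.
Qed.

Definition diffGal_one : diffGal := DiffGal (asboolT diffGal_one_subproof).

Definition diffGal_mul (s t : diffGal) : diffGal :=
  DiffGal (asboolT (diffGal_mul_subproof s t)).

Definition diffGal_inv (s : diffGal) : diffGal :=
  let: exist _ gP := cid (diffGal_inv_exists s) in
  let: And3 galg _ _ := gP in DiffGal (asboolT galg).

Fact diffGal_mulA : associative diffGal_mul.
Proof. by move=> s t r; apply: val_inj. Qed.

Fact diffGal_mul1g : left_id diffGal_one diffGal_mul.
Proof. by move=> s; apply: val_inj. Qed.

Fact diffGal_mulg1 : right_id diffGal_one diffGal_mul.
Proof. by move=> s; apply: val_inj. Qed.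

Fact diffGal_mulVg : left_inverse diffGal_one diffGal_inv diffGal_mul.
Proof.
move=> s; apply: val_inj; rewrite /= /diffGal_inv.
by case: cid => g [galg gs sg] /=; apply/funext => x /=; rewrite sg.
Qed.

Fact diffGal_mulgV : right_inverse diffGal_one diffGal_inv diffGal_mul.
Proof.
move=> s; apply: val_inj; rewrite /= /diffGal_inv.
by case: cid => g [galg gs sg] /=; apply/funext => x /=; rewrite gs.
Qed.

HB.instance Definition _ := isGroup.Build diffGal
  diffGal_mulA diffGal_mul1g diffGal_mulg1 diffGal_mulVg diffGal_mulgV.

End PicardVessiot.

(* Main.v *)
(* The derivation p |-> p^der + a p' of K[X] (polyder below) is intertwined with
   der by evaluation at any v such that v' = a, and it lowers the degree of
   monic polynomials. If it kills a polynomial of positive degree, the two top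
   coefficients show that a is a derivative in K; so only constants are killed.
   Applied to an annihilator of v of least degree this gives transcendence;
   applied to the denominators of a constant of K(v), and then to its numerator,
   it shows that K(v) has no new constants. The equation is a y'' - a' y' = 0,
   with fundamental system (1, v). An automorphism sends v to v + c with c a
   constant; conversely v + c is again a primitive of a, hence transcendental,
   so p(v)/q(v) |-> p(v + c)/q(v + c) is well defined. *)
From HB Require Import structures.
Require Import Defs.
From mathcomp Require Import all_boot all_algebra.
From mathcomp Require Import boolp.
From mathcomp Require Import ring.

Set Implicit Arguments.
Unset Strict Implicit.
Unset Printing Implicit Defensive.

Import GRing.Theory.
Local Open Scope ring_scope.

(** Makes the additive-map lemmas, such as [coef_map], available for [map_poly der]. *)
HB.instance Definition _ (F : diffFieldType) :=
  GRing.isZmodMorphism.Build F F der (@derB F).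

Section DerivationLemmas.
Variable F : diffFieldType.
Implicit Types x y : F.

Lemma der1 : der (1 : F) = 0.
Proof. by apply: (addIr (der 1)); rewrite add0r -{3}[1]mulr1 derM mulr1 mul1r. Qed.

Lemma derV x : der x^-1 = - der x / x ^+ 2.
Proof.
have [->|x0] := eqVneq x 0; first by rewrite invr0 der0 oppr0 mul0r.
apply: (mulfI x0); apply: (addrI (der x * x^-1)).
by rewrite -derM mulfV // der1; field.
Qed.

Lemma der_div x y : y != 0 -> der (x / y) = (der x * y - x * der y) / (y * y).
Proof. by move=> y0; rewrite derM derV; field. Qed.

End DerivationLemmas.

(** * The derivation of K[X] extending that of K with X' = a *)

Section PolyDerivation.
Variables (K : diffFieldType) (a : K).
Implicit Types p q : {poly K}.

Definition polyder p : {poly K} := map_poly der p + a *: p^`().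

Lemma coef_polyder p i : (polyder p)`_i = der p`_i + a * (p`_i.+1 *+ i.+1).
Proof. by rewrite coefD coef_map coefZ coef_deriv. Qed.

(** The leading coefficient 1 has derivative 0, and a p' has lower degree than p. *)
Lemma polyder_size_lt p : p \is monic -> (size (polyder p) < size p)%N.
Proof.
move=> pm; have: (0 < size p)%N by rewrite size_poly_gt0 monic_neq0.
have := monicP pm; rewrite lead_coefE; case sizep: (size p) => [|n] // /= pn _.
have sp : (size p <= n.+1)%N by rewrite sizep.
rewrite ltnS; apply/leq_sizeP => i; rewrite leq_eqVlt => /predU1P[<-|lt_ni].
  by rewrite coef_polyder pn der1 nth_default // mul0rn mulr0 addr0.
rewrite coef_polyder !nth_default ?der0 ?mul0rn ?mulr0 ?addr0 //.
  exact: leq_trans sp (ltnW _).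
exact: leq_trans sp lt_ni.
Qed.

Hypotheses (K0 : [pchar K] =i pred0) (nder_a : ~ exists b : K, der b = a).

(* The two top coefficients of polyder p = 0 exhibit a as a derivative:
   a = (- p_(n-1) / (n p_n))'. *)
Lemma polyder_eq0_size p : polyder p = 0 -> (size p <= 1)%N.
Proof.
move=> Dp; rewrite leqNgt; apply/negP => sp.
case sizep: (size p) sp => [|[|n]] // _; apply: nder_a.
have lc0 : p`_n.+1 != 0.
  by have := lead_coef_eq0 p; rewrite lead_coefE sizep /= => ->;
     rewrite -size_poly_eq0 sizep.
have n0 : (n.+1%:R : K) != 0 by rewrite ((pcharf0P K).1 K0).
have /eqP := coef_polyder p n.+1.
rewrite Dp coef0 (nth_default _ (_ : size p <= n.+2)%N) ?sizep //.
rewrite mul0rn mulr0 addr0 eq_sym => /eqP dlc.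
have /esym/eqP := coef_polyder p n; rewrite Dp coef0 addrC addr_eq0 => /eqP dn.
have k0 : p`_n.+1 *+ n.+1 != 0 by rewrite -mulr_natr mulf_neq0.
exists (- p`_n / (p`_n.+1 *+ n.+1)).
rewrite der_div // raddfMn /= dlc mul0rn mulr0 subr0 derN -dn.
by rewrite invfM mulrA !mulfK.
Qed.

End PolyDerivation.

(** * Values of polynomials at a primitive of [a] *)

Section Evaluation.
Variables (K M : diffFieldType) (j : {diffmorphism K -> M}) (a : K) (v : M).
Hypothesis dv : der v = j a.
Implicit Types p q : {poly K}.

Local Notation ev p := (map_poly j p).[v].

(** Induction on the Horner form: both sides follow the Leibniz rule and agree on constants and on
    X. *)
Lemma der_horner p : der (ev p) = ev (polyder a p).
Proof.
elim/poly_ind: p => [|p c IHp].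
  by rewrite /polyder derivC scaler0 addr0 !raddf0 horner0 der0.
have -> : polyder a (p * 'X + c%:P) = polyder a p * 'X + a *: p + (der c)%:P.
  rewrite /polyder raddfD /= derivD derivM derivX derivC addr0 mulr1.
  have -> : map_poly der (p * 'X) = map_poly der p * 'X.
    by apply/polyP => -[|i]; rewrite coef_map !coefMX /= ?der0 // coef_map.
  have -> : map_poly der c%:P = (der c)%:P by rewrite map_polyC.
  by rewrite -!mul_polyC; ring.
rewrite !rmorphD !rmorphM /= !map_polyX !map_polyC /= map_polyZ !hornerE /=.
by rewrite derD derM IHp dv -morph_der; ring.
Qed.

Hypotheses (K0 : [pchar K] =i pred0) (nder_a : ~ exists b : K, der b = a).

(* Differentiating q(v) x = p(v) replaces a monic denominator q of the constant
   x by polyder q, of smaller degree, until polyder q = 0 forces q = 1. *)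
Lemma denominator_descent x p q :
  der x = 0 -> q != 0 -> ev q * x = ev p -> exists r, x = ev r.
Proof.
move=> dx; have [n] := ubnP (size q); elim: n q p => // n IHn q p sq q0 qx.
pose l := (lead_coef q)^-1.
have l0 : l != 0 by rewrite invr_eq0 lead_coef_eq0.
have qm : l *: q \is monic by rewrite monicE lead_coefZ mulVf ?lead_coef_eq0.
have lqx : ev (l *: q) * x = ev (l *: p).
  by rewrite !map_polyZ !hornerZ -mulrA qx.
have [Dq0|Dq0] := eqVneq (polyder a (l *: q)) 0.
  have /(size1_polyC)Eq := polyder_eq0_size K0 nder_a Dq0.
  exists (l *: p); rewrite -lqx; move: qm; rewrite Eq monicE lead_coefC => /eqP ->.
  by rewrite rmorph1 hornerC mul1r.
apply: (IHn (polyder a (l *: q)) (polyder a (l *: p))) => //.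
  have := polyder_size_lt a qm; rewrite size_scale // => lt_D.
  by apply: leq_trans lt_D _.
have := congr1 der lqx; rewrite derM dx mulr0 addr0.
by rewrite !der_horner.
Qed.

(** Descent on the degree: if a monic p vanishes at v, so does the smaller [polyder a p]; once the
    latter is 0, p = 1, which has no root. *)
Lemma horner_neq0 p : p != 0 -> ev p != 0.
Proof.
have [n] := ubnP (size p); elim: n p => // n IHn p sp p0.
apply/negP => /eqP evp.
pose l := (lead_coef p)^-1.
have l0 : l != 0 by rewrite invr_eq0 lead_coef_eq0.
have pm : l *: p \is monic by rewrite monicE lead_coefZ mulVf ?lead_coef_eq0.
have evlp : ev (l *: p) = 0 by rewrite map_polyZ hornerZ evp mulr0.
have [Dp0|Dp0] := eqVneq (polyder a (l *: p)) 0.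
  have /(size1_polyC)Ep := polyder_eq0_size K0 nder_a Dp0.
  move: pm evlp; rewrite Ep monicE lead_coefC => /eqP ->.
  by rewrite rmorph1 hornerC => /eqP; rewrite oner_eq0.
suff /negP[] : ev (polyder a (l *: p)) != 0 by rewrite -der_horner evlp der0.
apply: IHn => //.
have := polyder_size_lt a pm; rewrite size_scale // => lt_D.
exact: leq_trans lt_D _.
Qed.

Lemma transcendental_primitive : ~ algebraicOver j v.
Proof. by move=> [p p0 /rootP pv]; have := horner_neq0 p0; rewrite pv eqxx. Qed.

Lemma horner_inj p q : ev p = ev q -> p = q.
Proof.
move=> epq; apply/eqP; rewrite -subr_eq0; apply: contraT => /horner_neq0.
by rewrite rmorphB hornerD hornerN epq subrr eqxx.
Qed.

(** Injectivity of evaluation turns the hypothesis into [polyder a p = 0], which leaves only a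
    constant polynomial. *)
Lemma constant_horner p : der (ev p) = 0 -> exists2 k, der k = 0 & ev p = j k.
Proof.
rewrite der_horner => Dp.
have Dp0 : polyder a p = 0 by apply: horner_inj; rewrite Dp rmorph0 horner0.
have /size1_polyC Ep := polyder_eq0_size K0 nder_a Dp0.
exists p`_0; last by rewrite {1}Ep map_polyC hornerC.
move: Dp0; rewrite Ep /polyder map_polyC derivC scaler0 addr0 /= => /eqP.
by rewrite polyC_eq0 coefC => /eqP.
Qed.

End Evaluation.

(** * Induction over a generated differential subfield *)

Section Adjunction.
Variables (K L : diffFieldType) (iota : {diffmorphism K -> L}).
Implicit Types us : seq L.

(** [in_adjoin] quantifies over subsets of L while [S] lives on the subtype; the image [T] of [S] in
    L bridges the two. *)
Lemma adjoin_ind us (S : {pred adjoin iota us}) :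
    diff_subfield S -> (forall k, adjoin_base iota us k \in S) ->
    (forall x, val x \in us -> x \in S) ->
  forall x, x \in S.
Proof.
move=> [[S1 SB SV] Sd] SK Su x.
pose T : {pred L} := [pred y | `[< exists2 z, z \in S & val z = y >]].
have : val x \in T.
  have /asboolP := valP x; apply.
  - split; first split.
    + by apply/asboolP; exists 1.
    + move=> _ _ /asboolP[y Sy <-] /asboolP[z Sz <-].
      by apply/asboolP; exists (y - z); [exact: SB|].
    + move=> _ _ /asboolP[y Sy <-] /asboolP[z Sz <-].
      by apply/asboolP; exists (y / z); [exact: SV|].
    + move=> _ /asboolP[y Sy <-].
      by apply/asboolP; exists (der y); [exact: Sd|].
  - by move=> k; apply/asboolP; exists (adjoin_base iota us k).
  - move=> y uy.
    have Ay : y \in in_adjoin iota us.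
      by apply/asboolP => R _ _; apply.
    by apply/asboolP; exists (Adjoin Ay); [exact: Su|].
by move=> /asboolP[z Sz /val_inj <-].
Qed.

End Adjunction.

Lemma fraction_diff_subfield (K M : diffFieldType) (j : {diffmorphism K -> M})
    (v : M) (a : K) :
  der v = j a ->
  diff_subfield [pred x | `[< exists p q : {poly K},
    (map_poly j q).[v] != 0 /\ x = (map_poly j p).[v] / (map_poly j q).[v] >]].
Proof.
move=> dv; split; first split.
- apply/asboolP; exists 1, 1; rewrite rmorph1 hornerC divr1; split=> //.
  exact: oner_neq0.
- move=> _ _ /asboolP[p [q [q0 ->]]] /asboolP[r [s [s0 ->]]]; apply/asboolP.
  exists (p * s - r * q), (q * s).
  rewrite rmorphB !rmorphM /= !hornerE /= mulf_neq0 //; split=> //; field.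
  by rewrite q0 s0.
- move=> _ _ /asboolP[p [q [q0 ->]]] /asboolP[r [s [s0 ->]]]; apply/asboolP.
  (* Closure under division includes division by 0, whose value is 0 by convention. *)
  have [->|r0] := eqVneq (map_poly j r).[v] 0.
    by exists 0, 1; rewrite mul0r invr0 mulr0 rmorph0 rmorph1 horner0 hornerC oner_neq0 mul0r.
  exists (p * s), (q * r); rewrite !rmorphM /= !hornerE /= mulf_neq0 //; split=> //; field.
  by rewrite q0 s0 r0.
- move=> _ /asboolP[p [q [q0 ->]]]; apply/asboolP.
  exists (polyder a p * q - p * polyder a q), (q * q).
  rewrite rmorphB !rmorphM /= !hornerE /= mulf_neq0 //; split=> //.
  by rewrite der_div // -!(der_horner dv).
Qed.

(** * The extension M = K(v), with [genM] as its induction principle *)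

Section PrimitiveExtension.
Variables (K M : diffFieldType) (j : {diffmorphism K -> M}) (a : K) (v : M).
Hypotheses (dv : der v = j a) (K0 : [pchar K] =i pred0).
Hypothesis nder_a : ~ exists b : K, der b = a.
Hypothesis genM : forall S : {pred M}, diff_subfield S ->
  (forall k, j k \in S) -> v \in S -> forall x, x \in S.
Implicit Types (p q : {poly K}) (x y : M) (c : constants K).

Local Notation ev w p := (map_poly j p).[w].

Lemma fractionP x : exists p q, q != 0 /\ x = ev v p / ev v q.
Proof.
suff /asboolP[p [q [q0 ->]]] : x \in [pred x | `[< exists p q : {poly K},
    ev v q != 0 /\ x = ev v p / ev v q >]].
  by exists p, q; split=> //; apply: contraNneq q0 => ->; rewrite rmorph0 horner0.
apply: genM => [|k|]; first exact: fraction_diff_subfield dv.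
- apply/asboolP; exists k%:P, 1.
  by rewrite rmorph1 map_polyC !hornerC divr1 oner_neq0.
- apply/asboolP; exists 'X, 1.
  by rewrite rmorph1 map_polyX hornerX hornerC divr1 oner_neq0.
Qed.

(** The descent clears the denominator of x, and a polynomial value that is constant comes from a
    constant of K. *)
Lemma constantP x : der x = 0 -> exists2 k, der k = 0 & x = j k.
Proof.
move=> dx; have [p [q [q0 Ex]]] := fractionP x.
have qv := horner_neq0 dv K0 nder_a q0.
have [|r Er] := denominator_descent (p := p) dv K0 nder_a dx q0.
  by rewrite Ex mulrC divfK.
by move: dx; rewrite Er => /(constant_horner dv K0 nder_a).
Qed.

Lemma primitive_PicardVessiot : PicardVessiot j.
Proof.
(* 0 is its own derivative. Both the leading coefficient of the equation and the wronskian reduce to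
   [a]. *)
have a0 : a != 0 by apply: contra_notN nder_a => /eqP ->; exists 0; rewrite der0.
split; last first.
  move=> x; split=> [/eqP/constantP[k dk ->]|[k /eqP dk <-]].
    by exists k => //; apply/eqP.
  by rewrite inE -morph_der dk rmorph0.
pose c (i : 'I_3) : K := nth 0 [:: 0; - der a; a] i.
pose w (i : 'I_2) : M := nth 0 [:: 1; v] i.
exists 2%N, c, w; split=> //.
  split.
    move=> i; rewrite /is_solution !big_ord_recl big_ord0 /= rmorph0 rmorphN.
    case: i => -[|[|//]] ? /=; rewrite /w /= ?der1 ?der0 ?dv -?morph_der; ring.
  (* The first row is (1, 0), so the determinant is v' = [j a]. *)
  rewrite /wronskian (expand_det_row _ 0) !big_ord_recl big_ord0 /cofactor.
  rewrite !det_mx11 !mxE /w /= der1 dv mul0r !addr0 mul1r expr0 mul1r.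
  by rewrite fmorph_eq0.
move=> x; apply/asboolP => S dS KS uS; apply: (genM dS KS).
(* [lift ord0 ord0] is the index 1, that of v. *)
by apply: uS; apply/codomP; exists (lift ord0 ord0).
Qed.

Section Endomorphisms.
Variable s : M -> M.
Hypotheses (sD : {morph s : x y / x + y}) (sM : {morph s : x y / x * y}).
Hypothesis sK : forall k, s (j k) = j k.

Lemma endo_horner w p : s (ev w p) = ev (s w) p.
Proof.
elim/poly_ind: p => [|p c IHp]; first by rewrite rmorph0 !horner0 -(rmorph0 j) sK.
by rewrite rmorphD rmorphM /= map_polyX map_polyC !hornerE /= sD sM IHp sK.
Qed.

Lemma endo_div x y : y != 0 -> s (x / y) = s x / s y.
Proof.
(* If s y = 0 then s 1 = s y s(1/y) = 0, yet s fixes 1 = [j 1]. *)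
move=> y0; have sy0 : s y != 0.
  apply/negP => /eqP sy; have := sK 1.
  by rewrite rmorph1 -(mulfV y0) sM sy mul0r (mulfV y0) => /esym/eqP; rewrite oner_eq0.
by apply: (mulIf sy0); rewrite -sM !divfK.
Qed.

Lemma endo_fraction p q : q != 0 ->
  s (ev v p / ev v q) = ev (s v) p / ev (s v) q.
Proof.
by move=> q0; rewrite endo_div ?endo_horner //; exact: (horner_neq0 dv).
Qed.

End Endomorphisms.

(** Every element is a fraction in v over K, so the image of v determines the map. *)
Lemma endo_eq s t : {morph s : x y / x + y} -> {morph s : x y / x * y} ->
    (forall k, s (j k) = j k) ->
    {morph t : x y / x + y} -> {morph t : x y / x * y} ->
    (forall k, t (j k) = j k) -> s v = t v -> s =1 t.
Proof.
move=> sD sM sK tD tM tK stv x; have [p [q [q0 ->]]] := fractionP x.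
by rewrite !endo_fraction // stv.
Qed.

(** * Translations of v by constants of K *)

Lemma der_translate c : der (v + j (val c)) = j a.
Proof. by rewrite derD dv -morph_der (eqP (valP c)) rmorph0 addr0. Qed.

(** Uses an arbitrarily chosen fraction representing x; [translateE] gives independence of the
    choice. *)
Definition translate c x : M :=
  let: exist p pP := cid (fractionP x) in let: exist q _ := cid pP in
  ev (v + j (val c)) p / ev (v + j (val c)) q.

(** Equal fractions at v cross-multiply to an identity in K[X], as v is transcendental; it can then
    be evaluated at v + c, where nonzero denominators stay nonzero because v + c is again a
    primitive of [a]. *)
Lemma translateE c p q : q != 0 ->
  translate c (ev v p / ev v q) = ev (v + j (val c)) p / ev (v + j (val c)) q.
Proof.
move=> q0; rewrite /translate; case: cid => r rP; case: cid => s [s0 E].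
have nz w : der w = j a -> ev w q != 0 /\ ev w s != 0.
  by move=> dw; split; exact: (horner_neq0 dw).
have [qv sv] := nz _ dv; have [qc sc] := nz _ (der_translate c).
apply/eqP; rewrite eqr_div // -!hornerM -!rmorphM /=; apply/eqP; congr (_.[_]).
congr (map_poly _ _); apply: (horner_inj dv K0 nder_a).
rewrite !rmorphM !hornerM /=; apply/eqP; rewrite -eqr_div //.
by rewrite E.
Qed.

Lemma translate_horner c p : translate c (ev v p) = ev (v + j (val c)) p.
Proof.
by have := translateE c p (oner_neq0 _); rewrite rmorph1 !hornerC !divr1.
Qed.

Lemma translate_base c k : translate c (j k) = j k.
Proof. by have := translate_horner c k%:P; rewrite map_polyC !hornerC. Qed.

Lemma translate_gen c : translate c v = v + j (val c).
Proof. by have := translate_horner c 'X; rewrite map_polyX !hornerX. Qed.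

Lemma translateD c : {morph translate c : x y / x + y}.
Proof.
move=> x y; have [p [q [q0 ->]]] := fractionP x.
have [r [s [s0 ->]]] := fractionP y.
have qs0 : q * s != 0 by rewrite mulf_neq0.
rewrite addf_div ?(horner_neq0 dv) // -!hornerM -hornerD -!rmorphM -rmorphD /=.
rewrite !translateE // addf_div ?(horner_neq0 (der_translate c)) //.
by rewrite rmorphD !rmorphM hornerD !hornerM.
Qed.

Lemma translateM c : {morph translate c : x y / x * y}.
Proof.
move=> x y; have [p [q [q0 ->]]] := fractionP x.
have [r [s [s0 ->]]] := fractionP y.
have qs0 : q * s != 0 by rewrite mulf_neq0.
rewrite mulf_div -!hornerM -!rmorphM /= !translateE //.
by rewrite mulf_div !rmorphM !hornerM.
Qed.

Lemma translate_der c : {morph translate c : x / der x >-> der x}.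
Proof.
move=> x; have [p [q [q0 ->]]] := fractionP x.
have qq0 : q * q != 0 by rewrite mulf_neq0.
have der_frac w : der w = j a -> der (ev w p / ev w q) =
    ev w (polyder a p * q - p * polyder a q) / ev w (q * q).
  move=> dw; rewrite der_div ?(horner_neq0 dw) // !(der_horner dw).
  by rewrite rmorphB !rmorphM !hornerE.
by rewrite translateE // !der_frac ?translateE //; exact: der_translate.
Qed.

(** Both sides are endomorphisms over K sending v to v + c + d. *)
Lemma translate_comp c d : translate (c + d) =1 translate c \o translate d.
Proof.
apply: endo_eq => //; try by [exact: translateD | exact: translateM | exact: translate_base].
- by move=> x y /=; rewrite !translateD.
- by move=> x y /=; rewrite !translateM.
- by move=> k /=; rewrite !translate_base.
by rewrite /= !translate_gen translateD translate_base translate_gen rmorphD addrA.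
Qed.

Lemma translate0 : translate 0 =1 id.
Proof.
apply: endo_eq => //; try by [exact: translateD | exact: translateM | exact: translate_base].
by rewrite translate_gen rmorph0 addr0.
Qed.

Lemma translate_galois c : is_diff_galois j (translate c).
Proof.
split; [exact: translateD | exact: translateM | exact: translate_der | |
        exact: translate_base].
exists (translate (- c)) => x.
  by rewrite -[LHS]/((_ \o _) x) -translate_comp addNr translate0.
by rewrite -[LHS]/((_ \o _) x) -translate_comp addrN translate0.
Qed.

Definition galois_translate c : diffGal j :=
  DiffGal (asboolT (translate_galois c)).

Lemma galois_translateD :
  {morph galois_translate : c d / c + d >-> (c * d)%g}.
Proof. by move=> c d; apply: val_inj; apply/funext => x; exact: translate_comp. Qed.

Lemma galois_translate_bij : bijective galois_translate.
Proof.
(* s v and v are both primitives of [a], so their difference is a constant of M, hence of K. *)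
have shift (s : diffGal j) : exists c : constants K, s v = v + j (val c).
  have [sD sM sd _ sK] := diffGalP s.
  have [|k dk Ek] := constantP (x := s v - v).
    by rewrite derB -sd dv sK subrr.
  have kK : k \in @is_constant K by apply/eqP.
  by exists (Constant kK); rewrite /= -Ek addrC subrK.
(* The inverse reads off the shift of v; it is unique because [j] is injective. *)
exists (fun s => sval (cid (shift s))) => [c|s]; case: cid => d /=.
  rewrite translate_gen => /addrI/fmorph_inj E.
  by apply: val_inj.
move=> Es; apply: val_inj; apply/funext => x /=.
have [sD sM _ _ sK] := diffGalP s.
apply: endo_eq => //; try by [exact: translateD | exact: translateM | exact: translate_base].
by rewrite translate_gen.
Qed.

End PrimitiveExtension.

Theorem mainTheorem7 (K L : diffFieldType) (iota : {diffmorphism K -> L})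
    (u : L) (a : K) :
  [pchar K] =i pred0 ->
  der u = iota a ->
  (~ exists b : K, der b = a) ->
  [/\ ~ algebraicOver iota u,
      PicardVessiot (adjoin_base iota [:: u])
    & exists phi : constants K -> diffGal (adjoin_base iota [:: u]),
        bijective phi /\ {morph phi : c d / c + d >-> (c * d)%g} ].
Proof.
move=> K0 du nder_a.
have Au : u \in in_adjoin iota [:: u].
  by apply/asboolP => S _ _; apply; rewrite inE.
pose v := Adjoin Au.
have dv : der v = adjoin_base iota [:: u] a by apply: val_inj.
have genM (S : {pred adjoin iota [:: u]}) : diff_subfield S ->
    (forall k, adjoin_base iota [:: u] k \in S) -> v \in S -> forall x, x \in S.
  move=> dS KS vS; apply: adjoin_ind => // x; rewrite inE => /eqP xu.
  by have -> : x = v by apply: val_inj.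
(* Transcendence concerns [u] in L itself; the other two claims use its copy [v] in the generated
   subfield. *)
split; first exact: transcendental_primitive du K0 nder_a.
  exact: primitive_PicardVessiot dv K0 nder_a genM.
exists (galois_translate dv K0 nder_a genM); split.
  exact: galois_translate_bij.
exact: galois_translateD.
Qed.
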